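(* Let $G$ be a discrete group. Let $\varphi\colon G\to\mathbb{C}$ be a function with $\varphi(e)=1$. If the Fourier multiplier $M_\varphi\colon\mathrm{VN}(G)\to\mathrm{VN}(G)$ is a PPT quantum channel then the group $G_\varphi$ is abelian.
   Context: $\mathrm{VN}(G)$ is the von Neumann algebra generated by the left translations $\lambda_s$, $s\in G$, on $\ell^2_G$, with canonical trace $\tau$, $\tau(\lambda_s)=\delta_{s,e}$. $M_\varphi$ is the weak* continuous map with $M_\varphi(\lambda_s)=\varphi(s)\lambda_s$ for $s\in G$. A quantum channel is a trace-preserving completely positive map (so here $\varphi$ is positive definite). A linear map $T\colon A\to B$ of $C^*$-algebras is PPT if both $T\colon A\to B$ and $T\colon A\to B^{\mathrm{op}}$ are completely positive ($B^{\mathrm{op}}$ the opposite algebra). $G_\varphi=\{s\in G:|\varphi(s)|=1\}$, which is a subgroup of $G$ when $\varphi$ is positive definite with $\varphi(e)=1$. *)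

(* Defs.v *)
From HB Require Import structures.
From mathcomp Require Import all_boot all_order all_algebra finmap.
From mathcomp Require Import all_classical all_reals all_analysis.
From mathcomp Require Import complex ring lra.

Set Implicit Arguments.
Unset Strict Implicit.
Unset Printing Implicit Defensive.

Import Order.TTheory GRing.Theory Num.Theory.
Import numFieldNormedType.Exports.
Import ComplexField.Normc.

Local Open Scope classical_set_scope.
Local Open Scope ring_scope.

Section Sums.
Variables (R : realType) (T : choiceType).

(* nsummable and nsum are meant for families g >= 0, whose sum over an arbitrary
   index type is the supremum of the finite partial sums. *)
Definition nsummable (g : T -> R) : Prop :=
  (\esum_(t in [set: T]) (g t)%:E < +oo)%E.

Definition nsum (g : T -> R) : R := fine (\esum_(t in [set: T]) (g t)%:E).

(* Sum of an absolutely summable family; for other families the value is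
   meaningless. *)
Definition rsum (f : T -> R) : R :=
  nsum (fun t => Num.max (f t) 0) - nsum (fun t => Num.max (- f t) 0).

Definition csum (f : T -> R[i]) : R[i] :=
  (rsum (fun t => complex.Re (f t)) +i* rsum (fun t => complex.Im (f t)))%C.

Definition csummable (f : T -> R[i]) : Prop := nsummable (fun t => normc (f t)).

Implicit Types (f g : T -> R) (t : T).

Lemma nsumE g : (forall t, 0 <= g t) -> nsummable g ->
  \esum_(t in [set: T]) (g t)%:E = (nsum g)%:E.
Proof.
move=> g0 sg; rewrite /nsum fineK// ge0_fin_numE//.
by apply: esum_ge0 => t _; rewrite lee_fin.
Qed.

Lemma nsummable_le f g : (forall t, f t <= g t) -> nsummable g -> nsummable f.
Proof. by move=> fg; apply: le_lt_trans; apply: le_esum => t _; rewrite lee_fin. Qed.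

Lemma nsum_ge0 g : (forall t, 0 <= g t) -> 0 <= nsum g.
Proof. by move=> g0; apply: fine_ge0; apply: esum_ge0 => t _; rewrite lee_fin. Qed.

Lemma eq_nsum f g : f =1 g -> nsum f = nsum g.
Proof. by move=> /funext ->. Qed.

Lemma nsumD f g : (forall t, 0 <= f t) -> (forall t, 0 <= g t) ->
  nsummable f -> nsummable g ->
  nsummable (fun t => f t + g t) /\ nsum (fun t => f t + g t) = nsum f + nsum g.
Proof.
move=> f0 g0 sf sg.
have E : (\esum_(t in [set: T]) (f t + g t)%:E = (nsum f + nsum g)%:E)%E.
  rewrite EFinD -!nsumE// -esumD//; last 2 first.
    by move=> t _; rewrite lee_fin.
    by move=> t _; rewrite lee_fin.
by rewrite /nsummable /nsum E ltry.
Qed.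

Lemma nsumZ (a : R) g : 0 <= a -> (forall t, 0 <= g t) -> nsummable g ->
  nsummable (fun t => a * g t) /\ nsum (fun t => a * g t) = a * nsum g.
Proof.
move=> a0 g0 sg.
suff E : (\esum_(t in [set: T]) (a * g t)%:E = (a * nsum g)%:E)%E.
  by rewrite /nsummable /nsum E ltry.
rewrite EFinM -nsumE// /esum -ereal_supZl//; last first.
  by apply/set0P; exists (\sum_(x \in (set0 : set T)) (g x)%:E)%E, set0 => //; exact: fsets_set0.
congr ereal_sup; rewrite image_comp; apply: eq_imagel => A [finA _] /=.
rewrite !fsbig_finite//= !sumEFin -EFinM mulr_sumr.
by [].
Qed.

Lemma nsummable_posneg f : nsummable (fun t => `|f t|) ->
  nsummable (fun t => Num.max (f t) 0) /\ nsummable (fun t => Num.max (- f t) 0).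
Proof.
move=> sf; split; apply: nsummable_le sf => t; rewrite ge_max normr_ge0 andbT.
  exact: ler_norm.
by rewrite -normrN ler_norm.
Qed.

Lemma rsumB f g : (forall t, 0 <= f t) -> (forall t, 0 <= g t) ->
  nsummable f -> nsummable g -> rsum (fun t => f t - g t) = nsum f - nsum g.
Proof.
move=> f0 g0 sf sg.
have m0 (h : T -> R) t : 0 <= Num.max (h t) 0 :> R by rewrite le_max lexx orbT.
have [sp sn] : nsummable (fun t => Num.max (f t - g t) 0) /\
    nsummable (fun t => Num.max (- (f t - g t)) 0).
  split; [apply: nsummable_le sf|apply: nsummable_le sg] => t;
  by rewrite ge_max; apply/andP; split => //; have := f0 t; have := g0 t; lra.
rewrite /rsum; apply/eqP; rewrite subr_eq addrAC -[_ == _]subr_eq opprK eq_sym.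
apply/eqP.
rewrite -(nsumD (m0 _) g0 sp sg).2 -(nsumD f0 (m0 _) sf sn).2.
apply: eq_nsum => t; case: (leP 0 (f t - g t)) => h.
  by rewrite [Num.max (- _) _]max_r; lra.
by rewrite [Num.max (- _) _]max_l; lra.
Qed.

Lemma rsum_ge0E f : (forall t, 0 <= f t) -> rsum f = nsum f.
Proof.
move=> f0; rewrite /rsum (_ : (fun t => Num.max (f t) 0) = f); last first.
  by apply/funext => t; rewrite max_l.
rewrite (_ : (fun t => Num.max (- f t) 0) = cst 0); last first.
  by apply/funext => t; rewrite max_r// oppr_le0.
by rewrite [X in _ - X](_ : _ = 0) ?subr0// /nsum esum1.
Qed.

Lemma posnegE (x : R) : x = Num.max x 0 - Num.max (- x) 0.
Proof.
case: (leP 0 x) => h; first by rewrite max_r ?subr0 ?oppr_le0.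
by rewrite max_l ?oppr_ge0 1?ltW// sub0r opprK.
Qed.

Lemma rsumD f g : nsummable (fun t => `|f t|) -> nsummable (fun t => `|g t|) ->
  rsum (fun t => f t + g t) = rsum f + rsum g.
Proof.
move=> /nsummable_posneg[fp fn] /nsummable_posneg[gp gn].
have m0 (h : T -> R) t : 0 <= Num.max (h t) 0 :> R by rewrite le_max lexx orbT.
have [s1 e1] := nsumD (m0 _) (m0 _) fp gp.
have [s2 e2] := nsumD (m0 _) (m0 _) fn gn.
have -> : (fun t => f t + g t) = (fun t =>
    (Num.max (f t) 0 + Num.max (g t) 0) -
    (Num.max (- f t) 0 + Num.max (- g t) 0)).
  by apply/funext => t; rewrite opprD addrACA -!posnegE.
rewrite rsumB// => [|t|t]; [|by apply: addr_ge0; rewrite le_max lexx orbT..].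
by rewrite e1 e2 /rsum; lra.
Qed.

Lemma rsumN f : rsum (fun t => - f t) = - rsum f.
Proof.
rewrite /rsum opprB; congr (_ - _); apply: eq_nsum => t.
by rewrite opprK.
Qed.

Lemma rsumZ (a : R) f : nsummable (fun t => `|f t|) ->
  rsum (fun t => a * f t) = a * rsum f.
Proof.
move=> /nsummable_posneg[fp fn].
have m0 (h : T -> R) t : 0 <= Num.max (h t) 0 :> R by rewrite le_max lexx orbT.
wlog a0 : a / 0 <= a => [W|].
  have [/W//|a0] := leP 0 a.
  rewrite (_ : (fun t => a * f t) = (fun t => - (- a * f t))); last first.
    by apply/funext => t; rewrite mulNr opprK.
  by rewrite rsumN W ?oppr_ge0 1?ltW// mulNr opprK.
have [s1 e1] := nsumZ a0 (m0 _) fp.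
have [s2 e2] := nsumZ a0 (m0 _) fn.
have -> : (fun t => a * f t) = (fun t =>
    a * Num.max (f t) 0 - a * Num.max (- f t) 0).
  by apply/funext => t; rewrite -mulrBr -posnegE.
rewrite rsumB// => [|t|t]; [|by apply: mulr_ge0 => //; rewrite le_max lexx orbT..].
by rewrite e1 e2 /rsum mulrBr.
Qed.

End Sums.

Section ComplexSums.
Variables (R : realType) (T : choiceType).
Implicit Types (z w : R[i]) (f g : T -> R[i]).

Lemma normc_ge0 z : 0 <= normc z.
Proof. by case: z => a b /=; exact: sqrtr_ge0. Qed.

Lemma sqr_normcE z : normc z ^+ 2 = complex.Re z ^+ 2 + complex.Im z ^+ 2.
Proof. by case: z => a b /=; rewrite sqr_sqrtr// addr_ge0// sqr_ge0. Qed.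

Lemma le_normc_Re z : `|complex.Re z| <= normc z.
Proof.
case: z => a b /=; rewrite -sqrtr_sqr ler_wsqrtr// lerDl sqr_ge0//.
Qed.

Lemma le_normc_Im z : `|complex.Im z| <= normc z.
Proof.
case: z => a b /=; rewrite -sqrtr_sqr ler_wsqrtr// lerDr sqr_ge0//.
Qed.

Lemma normc_conj z : normc z^*%C = normc z.
Proof. by case: z => a b /=; rewrite sqrrN. Qed.

Lemma normcZ2 z w : normc (z * w) ^+ 2 = normc z ^+ 2 * normc w ^+ 2.
Proof. by rewrite normcM exprMn. Qed.

Lemma normcD2 z w : normc (z + w) ^+ 2 <= 2 * normc z ^+ 2 + 2 * normc w ^+ 2.
Proof.
rewrite !sqr_normcE; case: z w => [a b] [c d] /=.
have := sqr_ge0 (a - c); have := sqr_ge0 (b - d); nra.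
Qed.

Lemma normcM_le z w : normc (z * w) <= normc z ^+ 2 + normc w ^+ 2.
Proof.
rewrite normcM; have := normc_ge0 z; have := normc_ge0 w.
have := sqr_ge0 (normc z - normc w); nra.
Qed.

Lemma csummable_Re f : csummable f -> nsummable (fun t => `|complex.Re (f t)|).
Proof. by apply: nsummable_le => t; exact: le_normc_Re. Qed.

Lemma csummable_Im f : csummable f -> nsummable (fun t => `|complex.Im (f t)|).
Proof. by apply: nsummable_le => t; exact: le_normc_Im. Qed.

Lemma eq_csum f g : f =1 g -> csum f = csum g.
Proof. by move=> /funext ->. Qed.

Lemma csumD f g : csummable f -> csummable g ->
  csum (fun t => f t + g t) = csum f + csum g.
Proof.
move=> sf sg; rewrite /csum.
rewrite [X in (_ +i* rsum X)%C](_ : _ = fun t => complex.Im (f t) + complex.Im (g t)); last first.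
  by apply/funext => t; case: (f t) (g t) => [a b] [c d].
rewrite [X in (rsum X +i* _)%C](_ : _ = fun t => complex.Re (f t) + complex.Re (g t)); last first.
  by apply/funext => t; case: (f t) (g t) => [a b] [c d].
rewrite !rsumD//; [exact: csummable_Im|exact: csummable_Im|
  exact: csummable_Re|exact: csummable_Re].
Qed.

Lemma csumZ z f : csummable f -> csum (fun t => z * f t) = z * csum f.
Proof.
move=> sf; rewrite /csum; case: z => a b.
have [sR sI] := (csummable_Re sf, csummable_Im sf).
have sZ (c : R) (h : T -> R) : nsummable (fun t => `|h t|) ->
    nsummable (fun t => `|c * h t|).
  move=> /(nsumZ (normr_ge0 c) (fun t => normr_ge0 (h t)))[].
  by under [in X in X -> _]eq_fun => t do rewrite -normrM.
rewrite [X in (_ +i* rsum X)%C](_ : _ = fun t =>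
    a * complex.Im (f t) + b * complex.Re (f t)); last first.
  by apply/funext => t; case: (f t) => [c d].
rewrite [X in (rsum X +i* _)%C](_ : _ = fun t =>
    a * complex.Re (f t) + (- b) * complex.Im (f t)); last first.
  by apply/funext => t; case: (f t) => [c d]/=; rewrite mulNr.
rewrite !rsumD ?rsumZ//; do ?exact: sZ.
by apply/eqP; rewrite eq_complex/= mulNr !eqxx.
Qed.

Lemma csum_conj f : csum (fun t => (f t)^*%C) = (csum f)^*%C.
Proof.
rewrite /csum/= -rsumN; congr (_ +i* _)%C.
- by congr rsum; apply/funext => t; case: (f t).
- by congr rsum; apply/funext => t; case: (f t).
Qed.

Lemma csum_real (g : T -> R) : (forall t, 0 <= g t) ->
  csum (fun t => (g t)%:C%C) = (nsum g)%:C%C.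
Proof.
move=> g0; rewrite /csum/= rsum_ge0E// (_ : rsum (fun=> 0) = 0)//.
by rewrite rsum_ge0E// /nsum esum1.
Qed.

Lemma csummableM f g : nsummable (fun t => normc (f t) ^+ 2) ->
  nsummable (fun t => normc (g t) ^+ 2) -> csummable (fun t => f t * (g t)^*%C).
Proof.
move=> sf sg; have [s _] := nsumD (fun t => sqr_ge0 _) (fun t => sqr_ge0 _) sf sg.
by apply: nsummable_le s => t; rewrite -(normc_conj (g t)); exact: normcM_le.
Qed.

End ComplexSums.

Section L2.
Variables (R : realType) (T : choiceType).

Definition l2_pred : {pred (T -> R[i])} :=
  [pred f | `[< nsummable (fun t => normc (f t) ^+ 2) >]].

Lemma l2_submod_closed : subsemimod_closed l2_pred.
Proof.
have sqn (f : T -> R[i]) t : 0 <= normc (f t) ^+ 2 by exact: sqr_ge0.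
split; [split|].
- apply/asboolP; rewrite /nsummable esum1 ?ltry// => t _ /=.
  by rewrite expr0n/= addr0 sqrtr0 expr0n.
- move=> f g /asboolP sf /asboolP sg; apply/asboolP.
  have [s1 _] := nsumZ (ler0n R 2) (sqn f) sf.
  have [s2 _] := nsumZ (ler0n R 2) (sqn g) sg.
  have [|t|s _] := nsumD _ _ s1 s2 => [t||]; do ?by rewrite mulr_ge0.
  by apply: nsummable_le s => t; exact: normcD2.
- move=> a f /asboolP sf; apply/asboolP.
  have [s _] := nsumZ (sqr_ge0 (normc a)) (sqn f) sf.
  by apply: nsummable_le s => t; rewrite -normcZ2.
Qed.

HB.instance Definition _ :=
  GRing.isSubSemiModClosed.Build R[i] (T -> R[i]) l2_pred l2_submod_closed.

Record l2 := L2 { l2_fun :> T -> R[i]; _ : l2_fun \in l2_pred }.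

HB.instance Definition _ := [isSub for l2_fun].
HB.instance Definition _ := [Choice of l2 by <:].
HB.instance Definition _ := [SubChoice_isSubLmodule of l2 by <:].

End L2.

Section InnerProduct.
Variables (R : realType) (T : choiceType).
Implicit Types (xi eta zeta : l2 R T) (a : R[i]) (s t : T).

Lemma conjcD (z w : R[i]) : (z + w)^*%C = z^*%C + w^*%C.
Proof. exact: rmorphD. Qed.

Lemma conjcB (z w : R[i]) : (z - w)^*%C = z^*%C - w^*%C.
Proof. exact: rmorphB. Qed.

Lemma conjcM (z w : R[i]) : (z * w)^*%C = z^*%C * w^*%C.
Proof. exact: rmorphM. Qed.

Lemma RcM (x y : R) : (x * y)%:C%C = x%:C%C * y%:C%C.
Proof. exact: rmorphM. Qed.

Lemma RcB (x y : R) : (x - y)%:C%C = x%:C%C - y%:C%C.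
Proof. exact: rmorphB. Qed.

(* Linear in the first argument, antilinear in the second. *)
Definition ip xi eta : R[i] := csum (fun t => xi t * (eta t)^*%C).

Definition l2norm xi : R := Num.sqrt (nsum (fun t => normc (xi t) ^+ 2)).

Let N2 xi : R := nsum (fun t => normc (xi t) ^+ 2).

Lemma l2_summable xi : nsummable (fun t => normc (xi t) ^+ 2).
Proof. by case: xi => f /= /asboolP. Qed.

Lemma l2P xi eta : (forall t, xi t = eta t) -> xi = eta.
Proof. by move=> e; apply: val_inj; apply/funext. Qed.

Lemma ip_summable xi eta : csummable (fun t => xi t * (eta t)^*%C).
Proof. by apply: csummableM; exact: l2_summable. Qed.

Lemma ipDl xi eta zeta : ip (xi + eta) zeta = ip xi zeta + ip eta zeta.
Proof.
rewrite /ip -csumD; [|exact: ip_summable..].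
by apply: eq_csum => t; rewrite -mulrDl.
Qed.

Lemma ipZl a xi eta : ip (a *: xi) eta = a * ip xi eta.
Proof.
rewrite /ip -csumZ; [|exact: ip_summable].
by apply: eq_csum => t; rewrite mulrA.
Qed.

Lemma ip_conj xi eta : ip xi eta = (ip eta xi)^*%C.
Proof.
by rewrite /ip -csum_conj; apply: eq_csum => t; rewrite rmorphM/= conjcK mulrC.
Qed.

Lemma ipDr xi eta zeta : ip zeta (xi + eta) = ip zeta xi + ip zeta eta.
Proof. by rewrite ip_conj ipDl conjcD -!ip_conj. Qed.

Lemma ipZr a xi eta : ip xi (a *: eta) = a^*%C * ip xi eta.
Proof. by rewrite ip_conj ipZl conjcM -ip_conj. Qed.

Lemma ip0l xi : ip 0 xi = 0.
Proof. by rewrite -(scale0r 0) ipZl mul0r. Qed.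

Lemma ipNl xi eta : ip (- xi) eta = - ip xi eta.
Proof. by rewrite -scaleN1r ipZl mulN1r. Qed.

Lemma ipBl xi eta zeta : ip (xi - eta) zeta = ip xi zeta - ip eta zeta.
Proof. by rewrite ipDl ipNl. Qed.

Lemma ipNr xi eta : ip xi (- eta) = - ip xi eta.
Proof. by rewrite ip_conj ipNl -mulN1r conjcM -ip_conj rmorphN1 mulN1r. Qed.

Lemma ipBr xi eta zeta : ip zeta (xi - eta) = ip zeta xi - ip zeta eta.
Proof. by rewrite ip_conj ipBl conjcB -!ip_conj. Qed.

Lemma ip_suml (I : Type) (r : seq I) (F : I -> l2 R T) eta :
  ip (\sum_(i <- r) F i) eta = \sum_(i <- r) ip (F i) eta.
Proof.
elim: r => [|i r IH]; first by rewrite !big_nil ip0l.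
by rewrite !big_cons ipDl IH.
Qed.

Lemma mulc_conj (z : R[i]) : z * z^*%C = (normc z ^+ 2)%:C%C.
Proof.
rewrite sqr_normcE; case: z => x y; apply/eqP; rewrite eq_complex/=.
by apply/andP; split; apply/eqP; ring.
Qed.

Lemma ip_norm xi : ip xi xi = (N2 xi)%:C%C.
Proof.
rewrite /N2 -csum_real => [|t]; last exact: sqr_ge0.
by apply: eq_csum => t; exact: mulc_conj.
Qed.

Lemma N2_ge0 xi : 0 <= N2 xi.
Proof. by apply: nsum_ge0 => t; exact: sqr_ge0. Qed.

Lemma sqr_l2norm xi : l2norm xi ^+ 2 = N2 xi.
Proof. by rewrite sqr_sqrtr// N2_ge0. Qed.

Lemma nsum_ge_fset (g : T -> R) (A : {fset T}) : (forall t, 0 <= g t) ->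
  nsummable g -> \sum_(t <- A) g t <= nsum g.
Proof.
move=> g0 sg; rewrite -lee_fin -nsumE//; apply: esum_ge.
exists [set` A]; first by split => //; exact: finite_fset.
by rewrite fsbig_finite//= set_fsetK sumEFin.
Qed.

Lemma nsum_le_fset (g : T -> R) M : (forall t, 0 <= g t) ->
  (forall A : {fset T}, \sum_(t <- A) g t <= M) -> nsummable g /\ nsum g <= M.
Proof.
move=> g0 gM.
have le : (\esum_(t in [set: T]) (g t)%:E <= M%:E)%E.
  apply: ge_ereal_sup => _ [A [finA _] <-].
  by rewrite fsbig_finite//= sumEFin lee_fin.
have sg : nsummable g by apply: le_lt_trans le _; rewrite ltry.
by split=> //; rewrite -lee_fin -nsumE.
Qed.

Lemma nsum_approx (g : T -> R) (e : R) : (forall t, 0 <= g t) ->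
  nsummable g -> 0 < e -> exists A : {fset T}, nsum g < \sum_(t <- A) g t + e.
Proof.
move=> g0 sg e0; apply: contrapT => /forallNP/= h.
have [] := @nsum_le_fset g (nsum g - e) g0.
  by move=> A; have /negP := h A; rewrite -leNgt lerBrDr.
by move=> _; lra.
Qed.

Lemma N2_eq0 xi : N2 xi = 0 -> xi = 0.
Proof.
move=> e; apply: l2P => t; apply: eq0_normc.
have := @nsum_ge_fset _ [fset t]%fset (fun t => sqr_ge0 _) (l2_summable xi).
rewrite big_seq_fset1 -/(N2 xi) e => h.
by apply/eqP; rewrite -sqrf_eq0 eq_le h sqr_ge0.
Qed.

Lemma N2Z a xi : N2 (a *: xi) = normc a ^+ 2 * N2 xi.
Proof.
apply: complexI.
rewrite -ip_norm ipZl ipZr mulrA mulc_conj ip_norm.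
exact/esym/(rmorphM (real_complex R)).
Qed.

Lemma N2D xi eta : N2 (xi + eta) <= 2 * N2 xi + 2 * N2 eta.
Proof.
have : N2 (xi + eta) + N2 (xi - eta) = 2 * N2 xi + 2 * N2 eta.
  apply: complexI; rewrite !rmorphD/= -!ip_norm !ipDl !ipDr !ipNl !ipNr.
  have -> : (2 * N2 xi)%:C%C = ip xi xi + ip xi xi.
    by rewrite ip_norm -rmorphD/=; congr (_%:C)%C; ring.
  have -> : (2 * N2 eta)%:C%C = ip eta eta + ip eta eta.
    by rewrite ip_norm -rmorphD/=; congr (_%:C)%C; ring.
  by ring.
by have := N2_ge0 (xi - eta); lra.
Qed.

Lemma ip_CS xi eta : normc (ip xi eta) ^+ 2 <= N2 xi * N2 eta.
Proof.
have [e0|] := eqVneq (N2 eta) 0.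
  move/N2_eq0 : e0 => ->.
  by rewrite ip_conj ip0l normc_conj normc0 expr0n mulr_ge0 ?N2_ge0.
move=> e0; have {e0}p0 : 0 < N2 eta by rewrite lt_neqAle N2_ge0 andbT eq_sym.
set c := ip xi eta.
pose b := (N2 eta)%:C%C *: xi - c *: eta.
have : N2 b = N2 eta * (N2 eta * N2 xi - normc c ^+ 2).
  apply: complexI; rewrite -ip_norm /b !ipBl !ipBr !ipZl !ipZr.
  rewrite (ip_conj eta xi) -/c !ip_norm RcM RcB -mulc_conj RcM.
  by rewrite conjc_real; ring.
move=> e; have := N2_ge0 b; rewrite e pmulr_rge0// subr_ge0.
by rewrite mulrC.
Qed.

Lemma ip_nondeg xi eta : (forall zeta, ip zeta xi = ip zeta eta) -> xi = eta.
Proof.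
move=> h; apply/eqP; rewrite -subr_eq0; apply/eqP; apply: N2_eq0.
by apply: complexI; rewrite -ip_norm ipBr h subrr.
Qed.

Definition delta_fun t : T -> R[i] := fun s => if s == t then 1 else 0.

Lemma fset_delta (g : T -> R) t (A : {fset T}) :
  (forall s, s != t -> g s = 0) ->
  \sum_(s <- A) g s = if t \in A then g t else 0.
Proof.
move=> g0; case: ifPn => tA.
  by rewrite (big_fsetD1 t)//= big_seq big1 ?addr0// => s; rewrite !inE => /andP[/g0].
rewrite big_seq big1// => s sA; apply: g0; apply: contraNneq tA => <-//.
Qed.

Lemma delta_subproof t : delta_fun t \in @l2_pred R T.
Proof.
apply/asboolP; apply: (@nsum_le_fset _ 1 _ _).1 => [s|A]; first exact: sqr_ge0.
rewrite (fset_delta (t := t)) => [|s st]; last first.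
  by rewrite /delta_fun (negbTE st) normc0 expr0n.
by rewrite /delta_fun eqxx normc1 expr1n; case: ifP.
Qed.

Definition delta t : l2 R T := L2 (delta_subproof t).

Lemma nsum_delta (g : T -> R) t : (forall s, 0 <= g s) ->
  (forall s, s != t -> g s = 0) -> nsum g = g t.
Proof.
move=> g0 gt; have [|sg le] := @nsum_le_fset g (g t) g0.
  by move=> A; rewrite (fset_delta _ gt); case: ifP.
apply/eqP; rewrite eq_le le /=.
have := nsum_ge_fset [fset t]%fset g0 sg.
by rewrite big_seq_fset1.
Qed.

Lemma rsum_delta (g : T -> R) t : (forall s, s != t -> g s = 0) -> rsum g = g t.
Proof.
move=> gt; rewrite /rsum !(@nsum_delta _ t) -?posnegE//.
- by move=> s; rewrite le_max lexx orbT.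
- by move=> s /gt ->; rewrite oppr0 maxxx.
- by move=> s; rewrite le_max lexx orbT.
- by move=> s /gt ->; rewrite maxxx.
Qed.

Lemma ip_delta xi t : ip xi (delta t) = xi t.
Proof.
rewrite /ip /csum !(@rsum_delta _ t)/= => [|s st|s st].
- by rewrite /delta_fun eqxx conjc1 mulr1; case: (xi t).
- by rewrite /delta_fun (negbTE st) conjc0 mulr0.
- by rewrite /delta_fun (negbTE st) conjc0 mulr0.
Qed.

Lemma ip_deltal xi t : ip (delta t) xi = (xi t)^*%C.
Proof. by rewrite ip_conj ip_delta. Qed.

Definition fcomb (c : T -> R[i]) (A : {fset T}) : l2 R T :=
  \sum_(t <- A) c t *: delta t.

Lemma ip_fcomb c A eta : ip (fcomb c A) eta = \sum_(t <- A) c t * (eta t)^*%C.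
Proof.
by rewrite ip_suml; apply: eq_bigr => t _; rewrite ipZl ip_deltal.
Qed.

Lemma fcombE c (A : {fset T}) t : t \in A -> fcomb c A t = c t.
Proof.
move=> tA; rewrite -ip_delta ip_fcomb (big_fsetD1 t)//= big_seq big1 ?addr0.
  by rewrite /delta_fun eqxx conjc1 mulr1.
by move=> s; rewrite !inE => /andP[st _]; rewrite /delta_fun (negbTE st) conjc0 mulr0.
Qed.

Lemma N2_fcomb c A : N2 (fcomb c A) = \sum_(t <- A) normc (c t) ^+ 2.
Proof.
apply: complexI; rewrite -ip_norm ip_fcomb rmorph_sum/=.
rewrite !big_seq; apply: eq_bigr => t tA; rewrite fcombE//.
by rewrite mulc_conj.
Qed.

Lemma N2_sub_fcomb xi A :
  N2 (xi - fcomb xi A) = N2 xi - \sum_(t <- A) normc (xi t) ^+ 2.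
Proof.
apply: complexI; rewrite -ip_norm !ipBl !ipBr RcB -N2_fcomb -!ip_norm.
have -> : ip (fcomb xi A) xi = ip (fcomb xi A) (fcomb xi A).
  by rewrite !ip_fcomb !big_seq; apply: eq_bigr => t tA; rewrite fcombE.
have -> : ip xi (fcomb xi A) = ip (fcomb xi A) (fcomb xi A).
  rewrite ip_conj.
  have -> : ip (fcomb xi A) xi = ip (fcomb xi A) (fcomb xi A).
    by rewrite !ip_fcomb !big_seq; apply: eq_bigr => t tA; rewrite fcombE.
  by rewrite -ip_conj.
by rewrite subrr subr0.
Qed.

Lemma functional_eq0 (F : l2 R T -> R[i]) (K : R) :
  (forall a xi eta, F (a *: xi + eta) = a * F xi + F eta) ->
  (forall xi, normc (F xi) ^+ 2 <= K * N2 xi) ->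
  (forall t, F (delta t) = 0) -> forall xi, F xi = 0.
Proof.
move=> linF bF F0 xi.
have FB u v : F (u - v) = F u - F v.
  by rewrite -scaleN1r addrC linF mulN1r addrC.
have F00 : F 0 = 0 by rewrite -(subrr 0) FB subrr.
have FA A : F (fcomb xi A) = 0.
  rewrite /fcomb; elim/big_ind: _ => [|u v Fu Fv|t _]//.
    by rewrite -(scale1r u) linF Fu Fv mulr0 addr0.
  by rewrite -(addr0 (_ *: _)) linF F0 F00 mulr0 addr0.
have K0 : 0 <= `|K| by [].
suff h e : 0 < e -> normc (F xi) ^+ 2 <= 0 + e.
  apply: eq0_normc; apply/eqP; rewrite -sqrf_eq0 eq_le sqr_ge0 andbT.
  by apply/ler_addgt0Pr => e e0; exact: h.
move=> e0; rewrite add0r.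
have e1 : 0 < e / (`|K| + 1) by rewrite divr_gt0// ltr_wpDl.
have [A hA] := nsum_approx (fun t => sqr_ge0 _) (l2_summable xi) e1.
have -> : F xi = F (xi - fcomb xi A) by rewrite FB FA subr0.
apply: (le_trans (bF _)); rewrite N2_sub_fcomb.
set d := N2 xi - _.
have d0 : 0 <= d by rewrite /d -N2_sub_fcomb N2_ge0.
have d1 : d <= e / (`|K| + 1) by rewrite lerBlDr addrC ltW.
apply: (@le_trans _ _ ((`|K| + 1) * (e / (`|K| + 1)))); last first.
  by rewrite mulrCA divff ?mulr1// gt_eqF// ltr_wpDl.
apply: (@le_trans _ _ ((`|K| + 1) * d)).
  by apply: ler_wpM2r => //; have := ler_norm K; lra.
by apply: ler_wpM2l => //; lra.
Qed.

Definition bounded_linear (V : l2 R T -> l2 R T) : Prop :=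
  linear V /\ exists K : R, forall xi, l2norm (V xi) <= K * l2norm xi.

Lemma bounded_linearP V : bounded_linear V <->
  linear V /\ exists2 K : R, 0 <= K & forall xi, N2 (V xi) <= K * N2 xi.
Proof.
split=> -[linV]; [move=> [K bV]|move=> [K K0 bV]]; split => //.
  exists (K ^+ 2) => [|xi]; first exact: sqr_ge0.
  rewrite -!sqr_l2norm -exprMn.
  by apply: lerXn2r => //; rewrite ?nnegrE ?sqrtr_ge0// (le_trans _ (bV xi))// sqrtr_ge0.
exists (Num.sqrt K) => xi; rewrite /l2norm -sqrtrM//.
apply: ler_wsqrtr; exact: bV.
Qed.

Lemma adjoint_vector V eta : bounded_linear V ->
  exists zeta, forall xi, ip (V xi) eta = ip xi zeta.
Proof.
move=> /bounded_linearP[linV [K K0 bV]].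
pose c t : R[i] := ip eta (V (delta t)).
have VD u v : V (u + v) = V u + V v by rewrite -{1}(scale1r u) linV scale1r.
have V0 : V 0 = 0 by apply: (addrI (V 0)); rewrite -VD !addr0.
have VZ a u : V (a *: u) = a *: V u by rewrite -[a *: u]addr0 linV V0 addr0.
have VA A : ip (V (fcomb c A)) eta = (\sum_(t <- A) normc (c t) ^+ 2)%:C%C.
  rewrite (_ : V _ = \sum_(t <- A) c t *: V (delta t)).
    rewrite ip_suml rmorph_sum/=; apply: eq_bigr => t _.
    by rewrite ipZl ip_conj mulc_conj.
  by rewrite /fcomb (big_morph V VD V0); apply: eq_bigr => t _; rewrite VZ.
have [|sc _] := @nsum_le_fset (fun t => normc (c t) ^+ 2) (K * N2 eta) (fun t => sqr_ge0 _).
  move=> A; set S := \sum_(t <- A) _.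
  have S0 : 0 <= S by apply: sumr_ge0 => t _; exact: sqr_ge0.
  have := ip_CS (V (fcomb c A)) eta; rewrite VA -/S.
  have -> : normc S%:C%C ^+ 2 = S ^+ 2 by rewrite sqr_normcE/= expr0n addr0.
  have := bV (fcomb c A); rewrite N2_fcomb -/S => h1 h2.
  have h3 : S * S <= S * (K * N2 eta).
    rewrite -expr2; apply: (le_trans h2).
    by rewrite mulrCA mulrA; apply: ler_wpM2r => //; rewrite N2_ge0.
  have [->|S1] := eqVneq S 0; first by rewrite mulr_ge0 ?N2_ge0.
  by rewrite -(ler_pM2l (_ : 0 < S))// lt_neqAle eq_sym S1.
pose zeta := L2 (asboolT sc : c \in @l2_pred R T).
exists zeta => xi; apply/eqP; rewrite -subr_eq0; apply/eqP.
apply: (@functional_eq0 (fun xi => ip (V xi) eta - ip xi zeta)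
  (2 * (K * N2 eta) + 2 * N2 zeta)).
- by move=> a u v; rewrite linV !ipDl !ipZl; ring.
- move=> u; apply: (le_trans (normcD2 _ _)).
  have -> : (2 * (K * N2 eta) + 2 * N2 zeta) * N2 u =
      2 * (K * N2 eta * N2 u) + 2 * (N2 zeta * N2 u) by ring.
  rewrite normcN; apply: lerD; apply: ler_wpM2l => //.
    apply: (le_trans (ip_CS _ _)).
    rewrite mulrC [leRHS](_ : _ = N2 eta * (K * N2 u)); last by ring.
    by apply: ler_wpM2l; [exact: N2_ge0|exact: bV].
  by rewrite mulrC ip_CS.
- by move=> t; rewrite ip_deltal -[zeta t]/(c t) /c -ip_conj subrr.
Qed.

Lemma adjoint_exists V : bounded_linear V ->
  exists2 W, bounded_linear W & forall xi eta, ip (V xi) eta = ip xi (W eta).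
Proof.
move=> blV; pose W eta := sval (cid (adjoint_vector eta blV)).
have WE xi eta : ip (V xi) eta = ip xi (W eta).
  by rewrite /W; case: cid => zeta /=.
exists W => //; apply/bounded_linearP; split.
  move=> a u v; apply: ip_nondeg => zeta.
  by rewrite -WE !ipDr !ipZr !WE.
have /bounded_linearP[linV [K K0 bV]] := blV.
exists K => // u.
have [->|W0] := eqVneq (N2 (W u)) 0; first by rewrite mulr_ge0 ?N2_ge0.
rewrite -(ler_pM2l (_ : 0 < N2 (W u))); last first.
  by rewrite lt_neqAle eq_sym W0 N2_ge0.
have := ip_CS (V (W u)) u; rewrite WE ip_norm sqr_normcE/= expr0n addr0 expr2.
move=> /le_trans; apply; rewrite mulrCA mulrA; apply: ler_wpM2r => //.
exact: N2_ge0.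
Qed.

End InnerProduct.

HB.mixin Record isStarRing A of GRing.PzRing A := {
  star : A -> A;
  starK : involutive star;
  starD : {morph star : x y / x + y};
  starM : forall x y, star (x * y) = star y * star x
}.

#[short(type="starRingType")]
HB.structure Definition StarRing := {A of isStarRing A & GRing.PzRing A}.

HB.instance Definition _ (A : starRingType) :=
  isStarRing.Build A^c (@starK A) (@starD A) (fun x y => @starM A y x).

Section CompletelyPositive.

Definition adjmx (A : starRingType) m n (x : 'M[A]_(m, n)) : 'M[A]_(n, m) :=
  map_mx star x^T.

(* For a C*-algebra A, the matrix algebra 'M[A]_n is again a C*-algebra, and the
   positive elements of a C*-algebra are exactly the elements y^* y. Positivity,
   hence complete positivity, depends only on the *-ring structure. *)
Definition positive_mx (A : starRingType) n (x : 'M[A]_n) : Prop :=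
  exists y : 'M[A]_n, x = adjmx y *m y.

Definition completely_positive (A B : starRingType) (u : A -> B) : Prop :=
  forall n (x : 'M[A]_n), positive_mx x -> positive_mx (map_mx u x).

(* B^c is the opposite algebra: the same *-structure with the product reversed. *)
Definition PPT (A B : starRingType) (u : A -> B) : Prop :=
  completely_positive u /\ @completely_positive A B^c u.

End CompletelyPositive.

Section BoundedOperators.
Variables (R : realType) (T : choiceType).

Definition bop_pred : {pred (l2 R T -> l2 R T)} :=
  [pred V | `[< bounded_linear V >]].

Lemma bop_submod_closed : subsemimod_closed bop_pred.
Proof.
split; [split|].
- apply/asboolP; split=> [a u v|]; first by rewrite /= scaler0 addr0.
  exists 0 => xi; rewrite mul0r -[leRHS](_ : l2norm (0 : l2 R T) = 0)//.
  apply/eqP; rewrite -sqrf_eq0 sqr_l2norm; apply/eqP; apply: complexI.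
  by rewrite -ip_norm ip0l.
- move=> V W /asboolP/bounded_linearP[linV [K K0 bV]].
  move=> /asboolP/bounded_linearP[linW [L L0 bW]].
  apply/asboolP/bounded_linearP; split.
    move=> a u v; rewrite -[LHS]/(V (a *: u + v) + W (a *: u + v)) linV linW.
    by rewrite -[RHS]/(a *: (V u + W u) + (V v + W v)) scalerDr addrACA.
  exists (2 * K + 2 * L) => [|u]; first by rewrite addr_ge0// mulr_ge0.
  rewrite -[(V + W) u]/(V u + W u); apply: (le_trans (N2D _ _)); rewrite [leRHS]mulrDl -!(mulrA 2).
  by apply: lerD; apply: ler_wpM2l.
- move=> a V /asboolP/bounded_linearP[linV [K K0 bV]].
  apply/asboolP/bounded_linearP; split.
    move=> b u v; rewrite -[LHS]/(a *: V (b *: u + v)) linV.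
    by rewrite -[RHS]/(b *: (a *: V u) + a *: V v) scalerDr !scalerA mulrC.
  exists (normc a ^+ 2 * K) => [|u]; first by rewrite mulr_ge0// sqr_ge0.
  by rewrite -[(a *: V) u]/(a *: V u) N2Z -[leRHS]mulrA; apply: ler_wpM2l => //; exact: sqr_ge0.
Qed.

HB.instance Definition _ :=
  GRing.isSubSemiModClosed.Build R[i] (l2 R T -> l2 R T) bop_pred bop_submod_closed.

Record bop := BOp { bop_fun :> l2 R T -> l2 R T; _ : bop_fun \in bop_pred }.

HB.instance Definition _ := [isSub for bop_fun].
HB.instance Definition _ := [Choice of bop by <:].
HB.instance Definition _ := [SubChoice_isSubLmodule of bop by <:].

Implicit Types x y z : bop.

Lemma bopP x y : (forall xi, x xi = y xi) -> x = y.
Proof. by move=> e; apply: val_inj; apply/funext. Qed.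

Lemma bop_bounded x : bounded_linear x.
Proof. by case: x => V /= /asboolP. Qed.

Lemma bop_linear x : linear x. Proof. exact: (bop_bounded x).1. Qed.

HB.instance Definition _ x :=
  GRing.isLinear.Build R[i] (l2 R T) (l2 R T) *:%R x (bop_linear x).

Lemma bop1_subproof : id \in bop_pred.
Proof.
by apply/asboolP; split=> // ; exists 1 => xi; rewrite mul1r.
Qed.

Lemma bopM_subproof x y : x \o y \in bop_pred.
Proof.
have /bounded_linearP[linV [K K0 bV]] := bop_bounded x.
have /bounded_linearP[linW [L L0 bW]] := bop_bounded y.
apply/asboolP/bounded_linearP; split=> [a u v /=|]; first by rewrite linW linV.
exists (K * L) => [|u]; first exact: mulr_ge0.
by apply: (le_trans (bV _)); rewrite -[leRHS]mulrA; apply: ler_wpM2l.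
Qed.

Definition bop1 : bop := BOp bop1_subproof.
Definition bopM x y : bop := BOp (bopM_subproof x y).

Lemma bopMA : associative bopM. Proof. by move=> x y z; exact: bopP. Qed.
Lemma bop1M : left_id bop1 bopM. Proof. by move=> x; exact: bopP. Qed.
Lemma bopM1 : right_id bop1 bopM. Proof. by move=> x; exact: bopP. Qed.
Lemma bopMDl : left_distributive bopM +%R.
Proof. by move=> x y z; exact: bopP. Qed.
Lemma bopMDr : right_distributive bopM +%R.
Proof. by move=> x y z; apply: bopP => xi; exact: (raddfD x). Qed.

HB.instance Definition _ :=
  GRing.Zmodule_isPzRing.Build bop bopMA bop1M bopM1 bopMDl bopMDr.

Lemma adjoint_bop x : exists y, forall xi eta, ip (x xi) eta = ip xi (y eta).
Proof.
have [W bW e] := adjoint_exists (bop_bounded x).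
by exists (BOp (asboolT bW : W \in bop_pred)).
Qed.

(* The adjoint is unique: see adj_uniq. *)
Definition adj x : bop := sval (cid (adjoint_bop x)).

Lemma adjE x xi eta : ip (x xi) eta = ip xi (adj x eta).
Proof. by rewrite /adj; case: cid => y /=. Qed.

Lemma adjEr x xi eta : ip xi (x eta) = ip (adj x xi) eta.
Proof. by rewrite ip_conj adjE -ip_conj. Qed.

Lemma adj_uniq x y : (forall xi eta, ip (x xi) eta = ip xi (y eta)) -> adj x = y.
Proof.
by move=> e; apply: bopP => eta; apply: ip_nondeg => xi; rewrite -adjE.
Qed.

Lemma adjK : involutive adj.
Proof. by move=> x; apply: adj_uniq => xi eta; rewrite adjEr. Qed.

Lemma adjD : {morph adj : x y / x + y}.
Proof.
by move=> x y; apply: adj_uniq => xi eta; rewrite ipDl ipDr !adjE.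
Qed.

Lemma adjM x y : adj (x * y) = adj y * adj x.
Proof. by apply: adj_uniq => xi eta; rewrite -!adjE. Qed.

HB.instance Definition _ := isStarRing.Build bop adjK adjD adjM.

Definition commutant (S : set bop) : set bop :=
  [set x | forall y, S y -> x * y = y * x].

End BoundedOperators.

Section GroupVonNeumannAlgebra.
Variables (R : realType) (G : groupType).
Local Notation C := R[i].
Local Notation H := (l2 R G).
Local Notation BH := (bop R G).

Definition translate (s : G) (xi : G -> C) : G -> C := fun t => xi (s^-1 * t)%g.

Lemma translate_nsum (s : G) (g : G -> R) :
  (\esum_(t in [set: G]) (g (s^-1 * t)%g)%:E =
   \esum_(t in [set: G]) (g t)%:E)%E.
Proof.
rewrite [RHS](@reindex_esum _ _ _ setT setT (fun t => s^-1 * t)%g)//.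
split=> [t _//|t u _ _ /mulgI//|t _].
by exists (s * t)%g => //; rewrite mulKg.
Qed.

Lemma translate_subproof s (xi : H) : translate s xi \in @l2_pred R G.
Proof.
apply/asboolP; rewrite /nsummable /translate.
rewrite (translate_nsum s (fun t => normc (xi t) ^+ 2)).
exact: l2_summable.
Qed.

Definition lambda_fun s (xi : H) : H := L2 (translate_subproof s xi).

Lemma lambda_subproof s : lambda_fun s \in @bop_pred R G.
Proof.
apply/asboolP; split=> [a u v|]; first by apply: l2P.
exists 1 => xi; rewrite mul1r /l2norm /nsum /lambda_fun /= /translate.
by rewrite (translate_nsum s (fun t => normc (xi t) ^+ 2)).
Qed.

Definition lambda s : BH := BOp (lambda_subproof s).

(* The von Neumann algebra generated by the set of left translations, which is
   closed under adjoints (adj_lambda), is its double commutant. *)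
Definition VN_pred : {pred BH} :=
  [pred x | `[< commutant (commutant (range lambda)) x >]].

Lemma lambdaM s t : lambda s * lambda t = lambda (s * t)%g.
Proof.
by apply: bopP => xi; apply: l2P => u /=; rewrite /translate/= invgM mulgA.
Qed.

Lemma lambda1 : lambda 1%g = 1.
Proof. by apply: bopP => xi; apply: l2P => u /=; rewrite /translate invg1 mul1g. Qed.

Lemma csum_translate s (f : G -> C) : csum (fun t => f (s^-1 * t)%g) = csum f.
Proof.
have nt (g : G -> R) : nsum (fun t => g (s^-1 * t)%g) = nsum g.
  by rewrite /nsum translate_nsum.
have rt (g : G -> R) : rsum (fun t => g (s^-1 * t)%g) = rsum g.
  by rewrite /rsum (nt (fun t => Num.max (g t) 0)) (nt (fun t => Num.max (- g t) 0)).
by rewrite /csum (rt (fun t => complex.Re (f t))) (rt (fun t => complex.Im (f t))).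
Qed.

Lemma adj_lambda s : adj (lambda s) = lambda s^-1%g.
Proof.
apply: adj_uniq => xi eta; rewrite /ip -[RHS](csum_translate s).
by apply: eq_csum => t /=; rewrite /translate invgK mulVKg.
Qed.

Lemma commutant_star (S : set BH) : (forall x, S x -> S (adj x)) ->
  forall x, commutant S x -> commutant S (adj x).
Proof.
move=> Sadj x Sx y Sy; apply: (inv_inj (@adjK _ _)).
by rewrite !adjM adjK Sx//; exact: Sadj.
Qed.

Lemma VN_adj x : x \in VN_pred -> adj x \in VN_pred.
Proof.
move=> /asboolP xVN; apply/asboolP; apply: commutant_star xVN => y.
apply: commutant_star => _ [s _ <-].
by rewrite adj_lambda; exists s^-1%g.
Qed.

Lemma VN_submod_closed : subsemimod_closed VN_pred.
Proof.
split; [split|].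
- by apply/asboolP => y _; rewrite mul0r mulr0.
- move=> x y /asboolP cx /asboolP cy; apply/asboolP => z Sz.
  by rewrite mulrDl mulrDr cx// cy.
- move=> a x /asboolP cx; apply/asboolP => z Sz; apply: bopP => xi.
  rewrite -[LHS]/(a *: (x * z) xi) cx//.
  by rewrite -[RHS]/(z (a *: x xi)) linearZ.
Qed.

Lemma VN_subring_closed : subring_closed VN_pred.
Proof.
split.
- by apply/asboolP => y _; rewrite mul1r mulr1.
- move=> x y /asboolP cx /asboolP cy; apply/asboolP => z Sz.
  by rewrite mulrBl mulrBr cx// cy.
- move=> x y /asboolP cx /asboolP cy; apply/asboolP => z Sz.
  by rewrite -mulrA cy// mulrA cx// mulrA.
Qed.

Record VN := MkVN { VN_op :> BH; _ : VN_op \in VN_pred }.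

HB.instance Definition _ := [isSub for VN_op].
HB.instance Definition _ := [Choice of VN by <:].
HB.instance Definition _ :=
  GRing.SubChoice_isSubPzRing.Build BH VN_pred VN VN_subring_closed.
HB.instance Definition _ :=
  GRing.SubZmodule_isSubLmodule.Build C BH VN_pred VN VN_submod_closed.

Lemma VN_opP (x : VN) : VN_op x \in VN_pred. Proof. by case: x. Qed.

Definition VN_star (x : VN) : VN := MkVN (VN_adj (VN_opP x)).

Lemma VN_starK : involutive VN_star.
Proof. by move=> x; apply: val_inj; exact: adjK. Qed.

Lemma VN_starD : {morph VN_star : x y / x + y}.
Proof. by move=> x y; apply: val_inj; exact: adjD. Qed.

Lemma VN_starM x y : VN_star (x * y) = VN_star y * VN_star x.
Proof. by apply: val_inj; exact: adjM. Qed.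

HB.instance Definition _ := isStarRing.Build VN VN_starK VN_starD VN_starM.

Lemma lambda_VN s : lambda s \in VN_pred.
Proof. by apply/asboolP => y cy; rewrite -cy. Qed.

Definition VNlambda s : VN := MkVN (lambda_VN s).

Definition VNtrace (x : VN) : C := ip (x (delta R 1%g)) (delta R 1%g).

Lemma VNtrace_lambda s : VNtrace (VNlambda s) = (s == 1%g)%:R.
Proof.
rewrite /VNtrace ip_delta /= /translate /delta_fun mulg1 invg_eq1.
by case: (s == 1%g).
Qed.

Record normal_data := NormalData {
  nd_left : nat -> H;
  nd_right : nat -> H;
  nd_left_summable : nsummable (fun n => l2norm (nd_left n) ^+ 2);
  nd_right_summable : nsummable (fun n => l2norm (nd_right n) ^+ 2) }.

(* The predual of a von Neumann algebra acting on H consists of the functionals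
   x |-> sum_n <x xi_n, eta_n> with sum_n |xi_n|^2 and sum_n |eta_n|^2 finite. *)
Definition normal_functional (d : normal_data) (x : VN) : C :=
  csum (fun n => ip (x (nd_left d n)) (nd_right d n)).

(* The coarsest topology making every functional of the predual continuous. *)
Definition weak_star : topologicalType := initial_topology
  (fun x : VN => (fun d => normal_functional d x) :
     {ptws normal_data -> C^o}).

Definition weak_star_continuous (u : VN -> VN) : Prop :=
  continuous (u : weak_star -> weak_star).

Definition Fourier_multiplier (phi : G -> C) (u : {linear VN -> VN}) : Prop :=
  weak_star_continuous u /\ forall s, u (VNlambda s) = phi s *: VNlambda s.

Definition trace_preserving (u : VN -> VN) : Prop :=
  forall x, VNtrace (u x) = VNtrace x.

Definition quantum_channel (u : VN -> VN) : Prop :=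
  trace_preserving u /\ completely_positive u.

Definition unimodular_set (phi : G -> C) : set G := [set s | `|phi s| = 1].

End GroupVonNeumannAlgebra.

(* Main.v *)
Require Import Defs.
From HB Require Import structures.
From mathcomp Require Import all_boot all_order all_algebra finmap.
From mathcomp Require Import all_classical all_reals all_analysis.
From mathcomp Require Import complex.

(** For g_1 = e, g_2 = s, g_3 = t the matrix (lambda (g_i^-1 g_j)) is positive,
    so, M being completely positive into the opposite algebra, its image under M
    is a Gram matrix over that algebra.
    Its entries (1,1) and (2,2) are 1 and its entry (1,2), phi(s) lambda_s, is
    unitary, which forces the second Gram vector to be the first one times that
    unitary. Hence the entries (2,3) and (1,3) are proportional in the opposite
    algebra, which says that lambda (s^-1 t) and lambda (t s^-1) are. *)

Set Implicit Arguments.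
Unset Strict Implicit.
Unset Printing Implicit Defensive.

Import Order.TTheory GRing.Theory Num.Theory.
Import numFieldNormedType.Exports.

Local Open Scope classical_set_scope.
Local Open Scope ring_scope.

Section Gram.
Variable A : starRingType.

(** This stands in for the definiteness of a C*-valued inner product: a column of length zero
    vanishes. *)
Definition star_proper : Prop := forall n (z : 'I_n -> A),
  \sum_k star (z k) * z k = 0 -> forall k, z k = 0.

Lemma star0 : star (0 : A) = 0.
Proof. by apply: (addrI (star 0)); rewrite -starD !addr0. Qed.

Lemma starN : {morph (@star A) : x / - x}.
Proof. by move=> x; apply: (addrI (star x)); rewrite -starD !subrr star0. Qed.

Lemma starB : {morph (@star A) : x y / x - y}.
Proof. by move=> x y; rewrite starD starN. Qed.

Lemma star_sum (I : Type) (r : seq I) (F : I -> A) :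
  star (\sum_(i <- r) F i) = \sum_(i <- r) star (F i).
Proof. by apply: (big_morph _ starD star0). Qed.

Lemma adjmx_mulE m n (y : 'M[A]_(m, n)) i j :
  (adjmx y *m y) i j = \sum_k star (y k i) * y k j.
Proof. by rewrite mxE; apply: eq_bigr => k _; rewrite !mxE. Qed.

Lemma positive_mx_unitary_entry n (P : 'M[A]_n) i j l :
  star_proper -> positive_mx P -> P i i = 1 -> P j j = 1 ->
  star (P i j) * P i j = 1 -> P j l = star (P i j) * P i l.
Proof.
move=> properA [y ->] Pii Pjj.
(* An opaque [a] is not expanded by the later [adjmx_mulE]. *)
have [a Pij] : exists a, (adjmx y *m y) i j = a by exists ((adjmx y *m y) i j).
rewrite Pij => aa.
have Pji : (adjmx y *m y) j i = star a.
  rewrite -Pij !adjmx_mulE star_sum; apply: eq_bigr => k _.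
  by rewrite starM starK.
have yj k : y k j - y k i * a = 0.
  move: k; apply: properA.
  (* The self-product of column j minus column i times [a], grouped so that each difference cancels:
     first [1 - star a * a], then [star a * a - star a * a]. *)
  transitivity ((adjmx y *m y) j j - (adjmx y *m y) j i * a
    - (star a * (adjmx y *m y) i j - star a * (adjmx y *m y) i i * a)).
    rewrite !adjmx_mulE !(mulr_sumr, mulr_suml) -!sumrB.
    apply: eq_bigr => k _.
    by rewrite starB starM mulrBl !mulrBr !mulrA.
  by rewrite Pii Pjj Pij Pji mulr1 aa !subrr.
rewrite !adjmx_mulE mulr_sumr; apply: eq_bigr => k _.
by rewrite (subr0_eq (yj k)) starM mulrA.
Qed.

Lemma positive_mx_row n (v : 'I_n.+1 -> A) :
  positive_mx (\matrix_(i, j) (star (v i) * v j)).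
Proof.
(* The row [v] is padded with zero rows, as [positive_mx] wants a square factor. *)
exists (\matrix_(k, j) if k == 0 then v j else 0).
apply/matrixP => i j; rewrite adjmx_mulE !mxE (bigD1 0)//= !mxE eqxx.
by rewrite big1 ?addr0// => k /negbTE k0; rewrite !mxE k0 mulr0.
Qed.

End Gram.

Section GroupVonNeumannAlgebra.
Variables (R : realType) (G : groupType).
Implicit Types (c : R[i]) (x : VN R G) (s t : G).

(** Tested against a vector [xi], the sum becomes the sum of the squared norms of the [z i xi]. *)
Lemma VN_proper : star_proper (VN R G).
Proof.
move=> n z z0 k; apply: val_inj; apply: bopP => xi.
have ge0 i : 0 <= ip (z i xi) (z i xi).
  by rewrite ip_norm ler0c nsum_ge0// => t; exact: sqr_ge0.
have z0xi : \sum_i ip (z i xi) (z i xi) = 0.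
  transitivity (ip (VN_op (\sum_i star (z i) * z i) xi) xi).
    rewrite (big_morph (fun x => ip (VN_op x xi) xi) (id1 := 0) (op1 := +%R)).
    - by apply: eq_bigr => i _; rewrite adjEr.
    - by move=> x y; rewrite -ipDl.
    - exact: ip0l.
  by rewrite z0; exact: ip0l.
have /(_ k isT) := psumr_eq0P (fun i _ => ge0 i) z0xi.
rewrite ip_norm => /complexI; exact: N2_eq0.
Qed.

(** With the product reversed, [star z * z] is the self-product in [VN R G] of the adjoint of
    [z]. *)
Lemma VN_converse_proper : star_proper (VN R G)^c.
Proof.
move=> n z z0 k.
apply: (can_inj (@starK (VN R G))); rewrite star0.
move: k; apply: VN_proper; rewrite -[RHS]z0.
by apply: eq_bigr => k _; rewrite starK.
Qed.

Lemma VN_starZ c x : star (c *: x) = c^*%C *: star x.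
Proof.
apply: val_inj; apply: adj_uniq => xi eta.
by rewrite -[VN_op (c *: x) xi]/(c *: x xi)
  -[val (_ *: star x) eta]/(_ *: adj x eta) ipZl ipZr conjcK adjE.
Qed.

Lemma star_VNlambda s : star (VNlambda R s) = VNlambda R s^-1%g.
Proof. by apply: val_inj; exact: adj_lambda. Qed.

Lemma VNlambdaM s t : VNlambda R s * VNlambda R t = VNlambda R (s * t)%g.
Proof. by apply: val_inj; exact: lambdaM. Qed.

Lemma VNlambda1 : VNlambda R 1%g = 1 :> VN R G.
Proof. by apply: val_inj; exact: lambda1. Qed.

Lemma VN_scalerAl c x y : c *: x * y = c *: (x * y).
Proof. by apply: val_inj; apply: bopP. Qed.

Lemma VN_scalerAr c x y : x * (c *: y) = c *: (x * y).
Proof. by apply: val_inj; apply: bopP => xi; exact: (linearZ_LR (VN_op x)). Qed.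

Lemma scaled_VNlambda_inj a b s t : b != 0 ->
  a *: VNlambda R s = b *: VNlambda R t -> s = t.
Proof.
(* At this coordinate the right side is [b], while the left side is 0 unless [s = t]. *)
move=> b0 /(congr1 (fun x : VN R G => x (delta R 1%g) t)) /=.
rewrite -[LHS]/(a * _) -[RHS]/(b * _).
rewrite /translate /delta_fun mulVg eqxx mulr1.
case: eqP => [/mulg1_eq|_]; last by move/eqP; rewrite mulr0 eq_sym (negbTE b0).
by rewrite invgK.
Qed.

End GroupVonNeumannAlgebra.

Theorem theorem10p12 (R : realType) (G : groupType) (phi : G -> R[i])
    (phi1 : phi 1%g = 1) (M : {linear VN R G -> VN R G})
    (M_phi : Fourier_multiplier phi M)
    (M_channel : quantum_channel M) (M_PPT : PPT M) :
  forall s t : G, unimodular_set phi s -> unimodular_set phi t ->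
    (s * t = t * s)%g.
Proof.
move=> s t phis phit.
have conj1 : (phi s)^*%C * phi s = 1.
  by rewrite mulrC -[_^*%C]/(Num.conj _) -normCK phis expr1n.
have t0 : phi t != 0 by rewrite -normr_eq0 phit oner_eq0.
have s0 : (phi s)^*%C != 0.
  by apply: contraTneq (oner_neq0 R[i]) => s0; rewrite -conj1 s0 mul0r eqxx.
have [_ cpop] := M_PPT.
pose g (i : 'I_3) : G := nth 1%g [:: 1%g; s; t] i.
pose Q : 'M[VN R G]_3 :=
  \matrix_(i, j) (star (VNlambda R (g i)) * VNlambda R (g j)).
pose P : 'M[(VN R G)^c]_3 := map_mx M Q.
have posP : positive_mx P by apply: cpop; exact: positive_mx_row.
have PE i j : P i j = phi ((g i)^-1 * g j)%g *: VNlambda R ((g i)^-1 * g j)%g.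
  by rewrite /P !mxE star_VNlambda VNlambdaM M_phi.2.
pose o k (lt_k3 : (k < 3)%N) : 'I_3 := Ordinal lt_k3.
have P01 : P (o 0 isT) (o 1 isT) = phi s *: VNlambda R s.
  by rewrite PE /g /= invg1 mul1g.
have P02 : P (o 0 isT) (o 2 isT) = phi t *: VNlambda R t.
  by rewrite PE /g /= invg1 mul1g.
have Pii i : P i i = 1 by rewrite PE mulVg phi1 scale1r VNlambda1.
(* Products over the opposite algebra are read from right to left in VN R G. *)
have unit_a : star (P (o 0 isT) (o 1 isT)) * P (o 0 isT) (o 1 isT) = 1.
  rewrite P01 -[LHS]/((phi s *: VNlambda R s) * star (phi s *: VNlambda R s)).
  rewrite VN_starZ star_VNlambda VN_scalerAl VN_scalerAr VNlambdaM scalerA.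
  by rewrite [phi s * _]mulrC conj1 scale1r mulgV VNlambda1.
have := positive_mx_unitary_entry (o 2 isT) (@VN_converse_proper R G) posP
  (Pii _) (Pii _) unit_a.
rewrite P01 P02 PE /g /=.
rewrite -[RHS]/((phi t *: VNlambda R t) * star (phi s *: VNlambda R s)).
rewrite VN_starZ star_VNlambda VN_scalerAl VN_scalerAr VNlambdaM scalerA.
(* The scalar on the right is a product of unimodular numbers, hence nonzero; [e] says that [t]
   commutes with the inverse of [s]. *)
move=> /scaled_VNlambda_inj; rewrite mulf_neq0// => /(_ isT) e.
by apply: (mulgI s^-1%g); rewrite mulKg mulgA e -mulgA mulVg mulg1.
Qed.
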